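(* Let $n\ge 4$ be an integer, let $J=[a,b]$ with $a<b$, let $f:J\to\mathbb{R}$ be a continuous differentiable function with $\sup_{x\in J}|f'(x)|<\infty$, and assume that there is a constant $\varepsilon>0$ such that $|f(x)-x|>\varepsilon$ for all $x\in J$. Let $0<\lambda<\tfrac12$, let $c_8>0$ be a constant, and for an integer $Q\ge1$ put $$L_J(Q,\lambda)=\left\{(x,y)\in\mathbb{R}^2:\ x\in J,\ |y-f(x)|<c_8\,Q^{-\lambda}\right\}.$$ Then there exist constants $c_9>0$ and $Q_0>0$, independent of $Q$, such that for every integer $Q>Q_0$ the set $L_J(Q,\lambda)$ contains at least $c_9\,Q^{n-\lambda}$ algebraic integer points $(\alpha,\beta)$ of degree $\deg\alpha=\deg\beta=n$ and height $H(\alpha)=H(\beta)\le Q$.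
   Context: For a polynomial $P(t)=a_nt^n+\ldots+a_1t+a_0$ with integer coefficients, its height is $H(P)=\max_{0\le j\le n}|a_j|$. An algebraic integer $\alpha$ of degree $n$ is a root of a monic polynomial $P(t)=t^n+a_{n-1}t^{n-1}+\ldots+a_1t+a_0$ with integer coefficients that is irreducible over $\mathbb{Q}$; its height is $H(\alpha)=H(P)$ (the leading coefficient $1$ is included in the maximum). An algebraic integer point is a point $(\alpha,\beta)\in\mathbb{R}^2$ such that $\alpha$ and $\beta$ are algebraically conjugate algebraic integers, i.e. roots of the same irreducible monic integer polynomial. The constants $c_9$ and $Q_0$ may depend on $n$, $J$, $f$, $\lambda$, $c_8$ and $\varepsilon$. *)

(* Defs.v *)
From HB Require Import structures.
From mathcomp Require Import all_boot all_order all_algebra finmap.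
From mathcomp Require Import all_classical all_reals all_analysis.

Set Implicit Arguments.
Unset Strict Implicit.
Unset Printing Implicit Defensive.

Import Order.TTheory GRing.Theory Num.Theory.
Import numFieldNormedType.Exports.

Local Open Scope classical_set_scope.
Local Open Scope ring_scope.

Definition height (P : {poly int}) : nat := (\max_(j < size P) absz (P`_j)%R)%N.

(* [x] is an algebraic integer with minimal polynomial [P]; by Gauss's lemma
   [P] is uniquely determined by [x]. *)
Definition alg_int_minpoly (R : realType) (x : R) (P : {poly int}) : Prop :=
  [/\ P \is monic,
      irreducible_poly (map_poly intr P : {poly rat}) &
      root (map_poly intr P : {poly R}) x].

(* The pairs of conjugate real algebraic integers of degree [n] and height at
   most [Q]; degree and height are those of the common minimal polynomial. *)
Definition alg_int_points (R : realType) (n Q : nat) : set (R * R) :=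
  [set p | exists P : {poly int},
     [/\ alg_int_minpoly p.1 P, alg_int_minpoly p.2 P,
         size P = n.+1 & (height P <= Q)%N]].

(* [df] is the derivative of [f] relative to the set [J]: the limit of the
   difference quotients is taken inside [J], hence it is one-sided at the
   endpoints of an interval, and the values of [f] outside [J] are irrelevant. *)
Definition has_derivative_on (R : realType) (J : set R) (f df : R -> R) : Prop :=
  forall x, J x -> (fun y => (f y - f x) / (y - x)) @ (within J x^') --> df x.

Definition strip (R : realType) (J : set R) (f : R -> R) (c8 lambda : R)
    (Q : nat) : set (R * R) :=
  [set p | J p.1 /\ `|p.2 - f p.1| < c8 * Q%:R `^ (- lambda)].

(* Main.v *)
Require Import Defs.
From HB Require Import structures.
From mathcomp Require Import all_boot all_order all_algebra finmap.
From mathcomp Require Import all_classical all_reals all_analysis.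
From mathcomp Require Import polyrcf.
From mathcomp Require Import ring lra zify.

Set Implicit Arguments.
Unset Strict Implicit.
Unset Printing Implicit Defensive.

Import Order.TTheory GRing.Theory Num.Theory.
Import numFieldNormedType.Exports.

Local Open Scope classical_set_scope.
Local Open Scope ring_scope.

(** The strip is so wide compared with the lattice of coefficients that the
    polynomials can be counted directly.

    Cut [a, b] into about Q^lambda pieces of centres x_i, each of length a
    small multiple of Q^(-lambda), and put y_i = f(x_i).  Since f is Lipschitz,
    every pair (alpha, beta) within a quarter of that length of (x_i, y_i) lies
    in the strip, and the squares around different centres are disjoint.

    Fix i and write n = r + 3.  Choose the coefficients of t^2, ..., t^(n-1)
    freely among about Q^(n-2) possibilities, such that the coefficient of t^2
    dominates the others.  There is exactly one choice of real coefficients of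
    t and 1 that makes the polynomial vanish at both x_i and y_i; round these
    two numbers, and then move them by at most K steps, where K is a small
    multiple of Q^(1-lambda).  The resulting P is O(K) at x_i and y_i, while

      P(t) = P(x) + D (t - x) + H(t) (t - x) (t - y),

    with H(t) at least of order Q, because H is the coefficient of t^2 up to
    smaller terms (high_part_divdiff2_ge).  As x_i and y_i are at distance at
    least epsilon, the last term forces a sign change of P at distance
    O(K / Q) = O(Q^(-lambda)) on either side of x_i and of y_i (root_near).
    So P has a root close to x_i and another close to y_i.

    All the lower coefficients are taken even and the constant one congruent
    to 2 modulo 4, so that P is irreducible by Eisenstein's criterion at 2.
    A root determines its minimal polynomial and its square, hence different
    choices give different points, and their number is of order
    Q^lambda * Q^(n-2) * (Q^(1-lambda))^2 = Q^(n-lambda). *)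

(** * Monic polynomials with even lower coefficients *)

Definition even_tail_poly (n : nat) (e : nat -> int) : {poly int} :=
  'X^n + \poly_(j < n) (2 * e j).

Lemma size_even_tail_poly n e : size (even_tail_poly n e) = n.+1.
Proof. by rewrite size_polyDl size_polyXn // ltnS size_poly. Qed.

Lemma coef_even_tail_poly n e j :
  (even_tail_poly n e)`_j = if (j < n)%N then 2 * e j else (j == n)%:R.
Proof.
rewrite coefD coefXn coef_poly; case: ltnP => [jn|_]; last by rewrite addr0.
by rewrite ltn_eqF // add0r.
Qed.

Lemma monic_even_tail_poly n e : even_tail_poly n e \is monic.
Proof.
by rewrite monicE lead_coefE size_even_tail_poly coef_even_tail_poly ltnn eqxx.
Qed.

(** Eisenstein's criterion at 2: the constant coefficient 4 c + 2 is not
    divisible by 4. *)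
Lemma irreducible_even_tail_poly n e (c : int) : (0 < n)%N -> e 0%N = 2 * c + 1 ->
  irreducible_poly (map_poly intr (even_tail_poly n e) : {poly rat}).
Proof.
move=> n0 e0; apply/irreducible_rat_int/(@eisenstein_crit 2%N) => //.
- by rewrite size_even_tail_poly -lt0n.
- by rewrite (monicP (monic_even_tail_poly n e)).
- rewrite coef_even_tail_poly n0 e0; apply/dvdzP => -[q hq].
  have : 2 * (2 * (q - c)) = 2 :> int by move: hq; rewrite !PoszM /=; lia.
  by lia.
- move=> i; rewrite size_even_tail_poly coef_even_tail_poly /= => ->.
  exact: dvdz_mulr.
Qed.

Lemma horner_even_tail_poly (R : comNzRingType) n e (t : R) :
  (map_poly intr (even_tail_poly n e)).[t] =
    t ^+ n + \sum_(j < n) 2 * (e j)%:~R * t ^+ j.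
Proof.
rewrite rmorphD /= map_polyXn hornerD hornerXn; congr (_ + _).
rewrite (@horner_coef_wide _ n); last first.
  by rewrite (leq_trans (size_poly _ _)) // size_poly.
apply: eq_bigr => j _; rewrite coef_map coef_poly ltn_ord /= intrM.
by [].
Qed.

(** Two irreducible rational polynomials with a common real root are not
    coprime, hence associate, hence equal as both are monic. *)
Lemma alg_int_minpoly_inj (R : realType) (x : R) (P P' : {poly int}) :
  alg_int_minpoly x P -> alg_int_minpoly x P' -> P = P'.
Proof.
move=> [mP [sP iP] rP] [mP' [sP' iP'] rP'].
set p : {poly rat} := map_poly intr P; set p' : {poly rat} := map_poly intr P'.
have toR (q : {poly int}) :
    map_poly intr q = map_poly (ratr : rat -> R) (map_poly intr q).
  by rewrite -map_poly_comp; apply: eq_map_poly => z /=; rewrite ratr_int.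
have ncop : size (gcdp p p') != 1%N.
  apply/negP; rewrite -/(coprimep p p') -(coprimep_map (ratr : {rmorphism rat -> R})).
  move=> /(@coprimep_root _ _ _ x); rewrite /p /p' -!toR => /(_ rP).
  by rewrite (rootP rP') eqxx.
have eqpp : p %= p'.
  rewrite -(eqp_rtrans (iP' _ ncop (dvdp_gcdr _ _))) eqp_sym.
  exact: iP ncop (dvdp_gcdl _ _).
have : p = p' by apply/eqP; rewrite -eqp_monic //; exact: monic_map.
by move/map_inj_poly; apply=> //; exact: intr_inj.
Qed.

(** * Divided differences and sign changes *)

(** First divided difference of t^j at x, y.  The recursion comes from
    multiplying the Newton form of t^j by t, written as x + (t - x) for the
    constant term and as y + (t - y) for the next one. *)
Fixpoint divdiff1 (R : comNzRingType) (x y : R) (j : nat) : R :=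
  if j is k.+1 then x ^+ k + y * divdiff1 x y k else 0.

(** Second divided difference of t^j at x, y, t. *)
Fixpoint divdiff2 (R : comNzRingType) (x y t : R) (j : nat) : R :=
  if j is k.+1 then divdiff1 x y k + t * divdiff2 x y t k else 0.

Lemma expr_newton (R : comNzRingType) (x y t : R) (j : nat) :
  t ^+ j = x ^+ j + divdiff1 x y j * (t - x)
                  + divdiff2 x y t j * ((t - x) * (t - y)).
Proof.
elim: j => [|j IHj]; first by rewrite !expr0 /=; ring.
by rewrite exprS IHj /= exprS; ring.
Qed.

Lemma norm_divdiff1_le (R : realFieldType) (M x y : R) (j : nat) :
  1 <= M -> `|x| <= M -> `|y| <= M -> `|divdiff1 x y j| <= j%:R * M ^+ j.
Proof.
move=> M1 xM yM; have M0 : 0 <= M by exact: le_trans M1.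
elim: j => [|j IHj] /=; first by rewrite normr0 mul0r.
apply: le_trans (ler_normD _ _) _; rewrite normrM normrX.
have h1 : `|x| ^+ j <= M ^+ j.+1.
  apply: (@le_trans _ _ (M ^+ j)); first by rewrite lerXn2r ?nnegrE.
  by rewrite exprS ler_peMl // exprn_ge0.
have h2 : `|y| * `|divdiff1 x y j| <= M * (j%:R * M ^+ j) by exact: ler_pM.
by apply: le_trans (lerD h1 h2) _; rewrite -natr1 exprS; lra.
Qed.

Lemma norm_divdiff2_le (R : realFieldType) (M x y t : R) (j : nat) :
  1 <= M -> `|x| <= M -> `|y| <= M -> `|t| <= M ->
  `|divdiff2 x y t j| <= (j ^ 2)%:R * M ^+ j.
Proof.
move=> M1 xM yM tM; have M0 : 0 <= M by exact: le_trans M1.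
elim: j => [|j IHj] /=; first by rewrite normr0 mul0r.
apply: le_trans (ler_normD _ _) _; rewrite normrM.
have Mj : 0 <= M ^+ j.+1 by rewrite exprn_ge0.
have h1 : `|divdiff1 x y j| <= j%:R * M ^+ j.+1.
  apply: le_trans (norm_divdiff1_le j M1 xM yM) _.
  by rewrite ler_wpM2l // exprS ler_peMl // exprn_ge0.
have h2 : `|t| * `|divdiff2 x y t j| <= M * ((j ^ 2)%:R * M ^+ j) by exact: ler_pM.
apply: le_trans (lerD h1 h2) _.
rewrite [leLHS](_ : _ = (j + j ^ 2)%N%:R * M ^+ j.+1).
  by rewrite ler_wpM2r // ler_nat; lia.
by rewrite natrD exprS; ring.
Qed.

Lemma divdiff2_2 (R : comNzRingType) (x y t : R) : divdiff2 x y t 2 = 1.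
Proof. by rewrite /= !(mulr0, addr0) expr0. Qed.

Arguments divdiff1 : simpl never.
Arguments divdiff2 : simpl never.

(** In Newton form, the affine part of p interpolates p at x and y, hence is at
    most 2 delta in absolute value at distance rho from x, whereas the quadratic
    part changes sign at x and is there at least h * rho * eps / 2: the factor
    t - y keeps its sign and is at least eps / 2.  Then p changes sign. *)
Lemma root_near (R : rcfType) (p : {poly R}) (x y eps rho delta h D : R)
    (H : R -> R) :
  0 < rho -> 2 * rho <= eps -> eps <= `|x - y| ->
  `|p.[x]| <= delta -> `|p.[y]| <= delta -> 0 <= h -> 4 * delta <= h * rho * eps ->
  (forall t, p.[t] = p.[x] + D * (t - x) + H t * ((t - x) * (t - y))) ->
  (forall t, `|t - x| <= rho -> h <= H t) ->
  exists2 z, `|z - x| <= rho & root p z.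
Proof.
move=> rho0 rhoe exy; rewrite !ler_norml => /andP[px1 px2] /andP[py1 py2] h0 dh pE hH.
(* Lagrange form of the affine part, cleared of its denominator y - x. *)
have pxE t : p.[t] * (y - x) =
    p.[x] * (y - t) + p.[y] * (t - x) + H t * ((t - x) * (t - y)) * (y - x).
  by rewrite (pE y) [in LHS](pE t); ring.
have Hm : h <= H (x - rho).
  by apply: hH; rewrite addrAC subrr add0r normrN ger0_norm // ltW.
have Hp : h <= H (x + rho).
  by apply: hH; rewrite addrAC subrr add0r ger0_norm // ltW.
have delta0 : 0 <= delta by lra.
(* The quadratic part beats the affine one on the side of x towards y (lo)
   and on the opposite side (hi); d is the distance from x to y. *)
have lo (u v d k : R) : u <= delta -> v <= delta -> eps <= d -> h <= k ->
    u * (d - rho) + v * rho <= k * rho * (d - rho) * d.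
  move=> ud vd ed hk; have d0 : 0 < d by lra.
  have h1 : u * (d - rho) <= delta * (d - rho) by rewrite ler_wpM2r //; lra.
  have h2 : v * rho <= delta * rho by rewrite ler_wpM2r //; lra.
  have h3 : h * rho * (eps / 2) <= k * rho * (d - rho).
    apply: ler_pM; try lra; first by rewrite mulr_ge0 // ltW.
    by rewrite ler_wpM2r // ltW.
  have h4 : delta * d <= k * rho * (d - rho) * d by rewrite ler_wpM2r //; lra.
  lra.
have hi (u v d k : R) : - delta <= u -> v <= delta -> eps <= d -> h <= k ->
    0 <= u * (d + rho) - v * rho + k * rho * (d + rho) * d.
  move=> ud vd ed hk; have d0 : 0 < d by lra.
  have h1 : - delta * (d + rho) <= u * (d + rho) by rewrite ler_wpM2r //; lra.
  have h2 : v * rho <= delta * rho by rewrite ler_wpM2r //; lra.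
  have h3 : h * rho * eps <= k * rho * (d + rho).
    apply: ler_pM; try lra; first by rewrite mulr_ge0 // ltW.
    by rewrite ler_wpM2r // ltW.
  have h4 : 4 * delta * d <= k * rho * (d + rho) * d by rewrite ler_wpM2r //; lra.
  have h5 : delta * rho <= delta * d by rewrite ler_wpM2l //; lra.
  have h6 : 0 <= delta * d by rewrite mulr_ge0 // ltW.
  lra.
have [z zI rz] : {z | z \in `[x - rho, x + rho] & root p z}.
  apply: polyrcf.poly_ivt; first lra.
  move: (pxE (x - rho)) (pxE (x + rho)) => pm pp.
  move: exy; rewrite ler_normr => /orP[exy|exy].
    have d0 : 0 < x - y by lra.
    rewrite mulrC mulr_ge0_le0 //.
      rewrite -(pmulr_lge0 _ d0).
      by have := hi p.[x] p.[y] (x - y) _ px1 py2 exy Hp; lra.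
    rewrite -(pmulr_lle0 _ d0).
    by have := lo p.[x] p.[y] (x - y) _ px2 py2 exy Hm; lra.
  have d0 : 0 < y - x by lra.
  rewrite mulr_ge0_le0 //.
    rewrite -(pmulr_lge0 _ d0) pm.
    by have := hi p.[x] p.[y] (y - x) _ px1 py2 _ Hm; lra.
  rewrite -(pmulr_lle0 _ d0) pp.
  by have := lo p.[x] p.[y] (y - x) _ px2 py2 _ Hp; lra.
exists z => //; rewrite ler_distl; move: zI; rewrite in_itv /=; lra.
Qed.

(** * The part of degree at least two *)

(** Half the coefficient of t^(k+2); the coefficient of t^2 is shifted by
    2 B m in order to dominate the others, which are below 2 m. *)
Definition mid_coef (B m : nat) (u : nat -> nat) (k : nat) : nat :=
  ((k == 0) * (B * m) + u k)%N.

(** The monomials are replaced by an arbitrary sequence w, because evaluation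
    and divided differences are all the same linear form applied to
    different sequences. *)
Definition high_part (R : comNzRingType) (r B m : nat) (u : nat -> nat) (w : nat -> R) : R :=
  w r.+3 + \sum_(k < r.+1) (2 * mid_coef B m u k)%:R * w k.+2.

Lemma high_part_newton (R : comNzRingType) r B m u (x y t : R) :
  high_part r B m u (GRing.exp t) = high_part r B m u (GRing.exp x)
    + high_part r B m u (divdiff1 x y) * (t - x)
    + high_part r B m u (divdiff2 x y t) * ((t - x) * (t - y)).
Proof.
rewrite /high_part [t ^+ r.+3](expr_newton x y).
rewrite [X in _ + X = _](_ : _ = \sum_(k < r.+1) (2 * mid_coef B m u k)%:R * x ^+ k.+2
    + (\sum_(k < r.+1) (2 * mid_coef B m u k)%:R * divdiff1 x y k.+2) * (t - x)
    + (\sum_(k < r.+1) (2 * mid_coef B m u k)%:R * divdiff2 x y t k.+2)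
      * ((t - x) * (t - y))).
  by ring.
rewrite !mulr_suml -!big_split; apply: eq_bigr => k _.
by rewrite (expr_newton x y t k.+2) /=; ring.
Qed.

Lemma mid_coef_le B m u k : (u k < m)%N -> (mid_coef B m u k <= B.+1 * m)%N.
Proof.
rewrite /mid_coef mulSn addnC => /ltnW um; apply: leq_add => //.
by case: (k == 0%N); rewrite ?mul1n ?mul0n.
Qed.

Lemma norm_high_part_le (R : realFieldType) r B m u (w : nat -> R) (C : R) :
  (0 < m)%N -> (forall k, (k < r.+1)%N -> (u k < m)%N) ->
  (forall j, (j <= r.+3)%N -> `|w j| <= C) ->
  `|high_part r B m u w| <= (1 + 2 * r.+1 * B.+1)%:R * C * m%:R.
Proof.
move=> m0 um wC; have C0 : 0 <= C by rewrite (le_trans _ (wC 0%N _)).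
apply: le_trans (ler_normD _ _) _.
have h1 : `|w r.+3| <= C * m%:R.
  by rewrite (le_trans (wC _ _)) // ler_peMr // ler1n.
have h2 : `|\sum_(k < r.+1) (2 * mid_coef B m u k)%:R * w k.+2| <=
    \sum_(k < r.+1) (2 * (B.+1 * m))%:R * C.
  apply: le_trans (ler_norm_sum _ _ _) _; apply: ler_sum => k _.
  rewrite normrM ger0_norm //; apply: ler_pM => //.
    by rewrite ler_nat leq_mul2l /= mid_coef_le // um.
  by apply: wC; rewrite !ltnS ltnW.
apply: le_trans (lerD h1 h2) _.
rewrite sumr_const card_ord -mulr_natl !natrM !natrD !natrM; lra.
Qed.

(** The second divided difference of t^2 is 1, so the coefficient of t^2
    contributes at least 2 B m; the other terms take away at most
    (2 r + 1) C m, which is at most half of it. *)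
Lemma high_part_divdiff2_ge (R : realFieldType) r B m u (x y t C : R) :
  (0 < m)%N -> (forall k, (k < r.+1)%N -> (u k < m)%N) ->
  (forall j, (j <= r.+3)%N -> `|divdiff2 x y t j| <= C) ->
  (2 * r + 1)%:R * C <= B%:R ->
  (B * m)%:R <= high_part r B m u (divdiff2 x y t).
Proof.
move=> m0 um wC CB; have C0 : 0 <= C by rewrite (le_trans _ (wC 0%N _)).
rewrite /high_part big_ord_recl divdiff2_2 mulr1.
have h1 : - (C * m%:R) <= divdiff2 x y t r.+3.
  have : `|divdiff2 x y t r.+3| <= C * m%:R.
    by rewrite (le_trans (wC _ _)) // ler_peMr // ler1n.
  by rewrite ler_norml => /andP[].
have h2 : `|\sum_(k < r) (2 * mid_coef B m u k.+1)%:R * divdiff2 x y t k.+3| <=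
    \sum_(k < r) (2 * m)%:R * C.
  apply: le_trans (ler_norm_sum _ _ _) _; apply: ler_sum => k _.
  rewrite normrM ger0_norm //; apply: ler_pM => //.
    by rewrite ler_nat leq_mul2l /= /mid_coef /= mul0n add0n ltnW // um // ltnS.
  by apply: wC; rewrite !ltnS ltnW.
move: h2; rewrite sumr_const card_ord -mulr_natl ler_norml => /andP[h2 _].
have h3 : (2 * (B * m))%:R <= (2 * mid_coef B m u 0)%:R :> R.
  by rewrite ler_nat leq_mul2l /= /mid_coef eqxx mul1n leq_addr.
have h4 : (2 * r + 1)%:R * C * m%:R <= B%:R * m%:R by rewrite ler_wpM2r.
move: h1 h2 h3 h4; rewrite !natrM natrD !natrM /= => h1 h2 h3 h4.
set S := \sum_(i < r) _; set S' := \sum_(i < r) _ in h2.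
have <- : S' = S by [].
lra.
Qed.

Definition half_coef (B m : nat) (u : nat -> nat) (e0 e1 : int) (j : nat) : int :=
  match j with
  | 0 => 2 * e0 + 1
  | 1 => e1
  | k.+2 => mid_coef B m u k
  end.

Lemma horner_half_coef (R : comNzRingType) r B m u e0 e1 (t : R) :
  (map_poly intr (even_tail_poly r.+3 (half_coef B m u e0 e1))).[t] =
    high_part r B m u (GRing.exp t) + 2 * e1%:~R * t + (4 * e0%:~R + 2).
Proof.
rewrite horner_even_tail_poly 2!big_ord_recl /= expr0 expr1 /high_part.
rewrite [X in _ + (_ + (_ + X))](_ : _ =
    \sum_(k < r.+1) (2 * mid_coef B m u k)%:R * t ^+ k.+2).
  by rewrite intrD intrM; ring.
by apply: eq_bigr => k _; rewrite natrM.
Qed.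

(** * Rounding the coefficients of degree at most one *)

(** The coefficients of t and 1 for which the polynomial with given higher
    part vanishes at x and y. *)
Definition linear_target (R : realType) r B m u (x y : R) : R :=
  - high_part r B m u (divdiff1 x y).

Definition const_target (R : realType) r B m u (x y : R) : R :=
  - high_part r B m u (GRing.exp x) - linear_target r B m u x y * x.

(** Rounding to an even coefficient of t, and to a constant coefficient
    congruent to 2 modulo 4, followed by a shift by k and l steps. *)
Definition rounded_coef (R : realType) r B m (x y : R) (u : nat -> nat) (k l : nat) :=
  half_coef B m u (Num.ceil (const_target r B m u x y / 4) + l%:Z)
                  (Num.ceil (linear_target r B m u x y / 2) + k%:Z).

Definition rounded_poly (R : realType) r B m (x y : R) (u : nat -> nat) (k l : nat) :=
  even_tail_poly r.+3 (rounded_coef r B m x y u k l).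

Lemma rounded_coef0E (R : realType) r B m (x y : R) u k l :
  (rounded_coef r B m x y u k l 0%N)%:~R =
    2 * (Num.ceil (const_target r B m u x y / 4) + l%:Z)%:~R + 1 :> R.
Proof. by rewrite /rounded_coef [half_coef _ _ _ _ _ _]/= [LHS]intrD intrM. Qed.

Lemma shifted_ceil_bounds (R : realType) (A : R) (k : nat) :
  A + k%:R <= (Num.ceil A + k%:Z)%:~R <= A + k%:R + 1.
Proof.
have /andP[h1 h2] := ceil_itv A.
rewrite intrD; rewrite intrB in h1.
have -> : (k%:Z)%:~R = k%:R :> R by [].
lra.
Qed.

Lemma rounded_poly_horner_left (R : realType) r B m (x y : R) u k l :
  (map_poly intr (rounded_poly r B m x y u k l)).[x] =
  (2 * (rounded_coef r B m x y u k l 1%N)%:~R - linear_target r B m u x y) * x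
  + (2 * (rounded_coef r B m x y u k l 0%N)%:~R - const_target r B m u x y).
Proof.
rewrite horner_half_coef rounded_coef0E [rounded_coef _ _ _ _ _ _ _ _ _]/=.
by rewrite /const_target; ring.
Qed.

Lemma rounded_poly_horner_right (R : realType) r B m (x y : R) u k l :
  (map_poly intr (rounded_poly r B m x y u k l)).[y] =
  (2 * (rounded_coef r B m x y u k l 1%N)%:~R - linear_target r B m u x y) * y
  + (2 * (rounded_coef r B m x y u k l 0%N)%:~R - const_target r B m u x y).
Proof.
rewrite horner_half_coef (high_part_newton _ _ _ _ x y y) rounded_coef0E.
by rewrite [rounded_coef _ _ _ _ _ _ _ _ _]/= /const_target /linear_target; ring.
Qed.

Lemma norm_linear_error (R : realType) r B m (x y : R) u (k l K : nat) : (k < K)%N ->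
  `|2 * (rounded_coef r B m x y u k l 1%N)%:~R - linear_target r B m u x y| <= 2 * K%:R.
Proof.
move=> kK; have {kK} : k%:R + 1 <= K%:R :> R by rewrite natr1 ler_nat.
have := shifted_ceil_bounds (linear_target r B m u x y / 2) k.
have k0 : 0 <= k%:R :> R by [].
move=> /= /andP[h1 h2] h3; rewrite ler_norml; lra.
Qed.

Lemma norm_const_error (R : realType) r B m (x y : R) u (k l K : nat) : (l < K)%N ->
  `|2 * (rounded_coef r B m x y u k l 0%N)%:~R - const_target r B m u x y| <= 6 * K%:R.
Proof.
move=> lK; have {lK} : l%:R + 1 <= K%:R :> R by rewrite natr1 ler_nat.
have := shifted_ceil_bounds (const_target r B m u x y / 4) l.
have l0 : 0 <= l%:R :> R by [].
rewrite rounded_coef0E.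
move=> /= /andP[h1 h2] h3; rewrite ler_norml; lra.
Qed.

Lemma rounded_poly_small (R : realType) r B m (x y z M : R) u (k l K : nat) :
  1 <= M -> `|z| <= M -> z = x \/ z = y -> (k < K)%N -> (l < K)%N ->
  `|(map_poly intr (rounded_poly r B m x y u k l)).[z]| <= 8 * K%:R * M.
Proof.
move=> M1 zM zxy kK lK.
have h1 := norm_linear_error r B m x y u l kK.
have h2 := norm_const_error r B m x y u k lK.
have -> : (map_poly intr (rounded_poly r B m x y u k l)).[z] =
  (2 * (rounded_coef r B m x y u k l 1%N)%:~R - linear_target r B m u x y) * z
  + (2 * (rounded_coef r B m x y u k l 0%N)%:~R - const_target r B m u x y).
  by case: zxy => ->; rewrite (rounded_poly_horner_left, rounded_poly_horner_right).
apply: le_trans (ler_normD _ _) _; rewrite normrM.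
have h3 := ler_pM (normr_ge0 _) (normr_ge0 _) h1 zM.
apply: le_trans (lerD h3 h2) _.
have : 6 * K%:R * 1 <= 6 * K%:R * M by rewrite ler_wpM2l // mulr_ge0.
lra.
Qed.

(** Stated for z either of the two points, z' being the other one, so that it
    yields both roots; the rounding is not symmetric in x and y but the Newton
    form may be taken at the points in either order. *)
Lemma rounded_poly_root (R : realType) r B m (x y z z' M C rho eps : R) u (k l K : nat) :
  1 <= M -> `|x| + 1 <= M -> `|y| + 1 <= M ->
  (z = x /\ z' = y) \/ (z = y /\ z' = x) ->
  (0 < m)%N -> (forall i, (i < r.+1)%N -> (u i < m)%N) ->
  (r.+3 ^ 2)%:R * M ^+ r.+3 <= C -> (2 * r + 1)%:R * C <= B%:R ->
  (k < K)%N -> (l < K)%N ->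
  0 < rho -> rho <= 1 -> 2 * rho <= eps -> eps <= `|x - y| ->
  32 * K%:R * M <= (B * m)%:R * rho * eps ->
  exists2 w, `|w - z| <= rho & root (map_poly intr (rounded_poly r B m x y u k l)) w.
Proof.
move=> M1 xM yM zz m0 um MC CB kK lK rho0 rho1 rhoe exy KB.
have xM' : `|x| <= M by lra.
have yM' : `|y| <= M by lra.
have zM : `|z| + 1 <= M by case: zz => -[-> _].
have zM' : `|z| <= M by lra.
have z'M' : `|z'| <= M by case: zz => -[_ ->].
apply: (@root_near _ _ z z' eps rho (8 * K%:R * M) (B * m)%:R
  (high_part r B m u (divdiff1 z z') +
   2 * (rounded_coef r B m x y u k l 1%N)%:~R)
  (fun t => high_part r B m u (divdiff2 z z' t))) => //.
- by case: zz => -[-> ->] //; rewrite distrC.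
- by apply: rounded_poly_small => //; case: zz => -[-> _]; [left|right].
- by apply: rounded_poly_small => //; case: zz => -[_ ->]; [right|left].
- lra.
- move=> t; rewrite !horner_half_coef (high_part_newton _ _ _ _ z z' t) /=; ring.
- move=> t tz; apply: (@high_part_divdiff2_ge _ _ _ _ _ _ _ _ C) => // j jr.
  have tM : `|t| <= M.
    have := ler_normD (t - z) z; rewrite subrK; lra.
  apply: le_trans (norm_divdiff2_le j M1 zM' z'M' tM) _.
  apply: le_trans MC; apply: ler_pM => //; first by rewrite exprn_ge0 //; lra.
    by rewrite ler_nat leq_exp2r.
  by rewrite ler_weXn2l.
Qed.

Lemma height_rounded_poly (R : realType) r B m (x y M C : R) u (k l K D Q : nat) :
  1 <= M -> `|x| <= M -> `|y| <= M ->
  (0 < m)%N -> (forall i, (i < r.+1)%N -> (u i < m)%N) ->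
  (r.+3 ^ 2)%:R * M ^+ r.+3 <= C -> (2 * r + 1)%:R * C <= B%:R ->
  (k < K)%N -> (l < K)%N -> (K <= m)%N ->
  (1 + 2 * r.+1 * B.+1)%:R * C * (1 + M) + 6 <= D%:R -> (D * m <= Q)%N ->
  (height (rounded_poly r B m x y u k l) <= Q)%N.
Proof.
move=> M1 xM yM m0 um MC CB kK lK Km WD DQ.
have M0 : 0 <= M by lra.
set W : R := (1 + 2 * r.+1 * B.+1)%:R * C in WD.
have M2 : 1 <= M ^+ r.+3 by rewrite exprn_ege1.
have C1 : 1 <= C.
  apply: le_trans MC; rewrite -[leLHS]mulr1; apply: ler_pM => //.
  by rewrite ler1n expn_gt0.
have nat_le (j : nat) : (j <= r.+3)%N -> (j <= r.+3 ^ 2)%N.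
  by move=> /leq_trans; apply; rewrite -[X in (X <= _)%N]expn1 leq_exp2l.
have A1 : `|linear_target r B m u x y| <= W * m%:R.
  rewrite normrN; apply: norm_high_part_le => // j jr.
  apply: le_trans (norm_divdiff1_le j M1 xM yM) _.
  apply: le_trans MC; apply: ler_pM => //; first by rewrite exprn_ge0.
    by rewrite ler_nat nat_le.
  by rewrite ler_weXn2l.
have A0 : `|const_target r B m u x y| <= W * m%:R * (1 + M).
  apply: le_trans (ler_normB _ _) _; rewrite mulrDr mulr1 normrN normrM lerD //.
    apply: norm_high_part_le => // j jr; rewrite normrX.
    apply: le_trans MC; rewrite -[leLHS]mul1r; apply: ler_pM => //.
      by rewrite ler1n expn_gt0.
    apply: (@le_trans _ _ (M ^+ j)); first by rewrite lerXn2r ?nnegrE.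
    by rewrite ler_weXn2l.
  exact: ler_pM.
have W0 : 0 <= W * m%:R by apply: le_trans A1.
have W1 : 2 * B.+1%:R <= W.
  apply: (@le_trans _ _ ((1 + 2 * r.+1 * B.+1)%:R * 1)).
    by rewrite mulr1 -natrM ler_nat; nia.
  by rewrite ler_wpM2l.
have KmR : K%:R <= m%:R :> R by rewrite ler_nat.
have m1 : 1 <= m%:R :> R by rewrite ler1n.
have DmQ : D%:R * m%:R <= Q%:R :> R by rewrite -natrM ler_nat.
have {}DmQ : (W * (1 + M) + 6) * m%:R <= Q%:R.
  by apply: le_trans DmQ; rewrite ler_wpM2r.
have WM : 0 <= W * m%:R * M by rewrite mulr_ge0.
have coef_le j : `|((rounded_poly r B m x y u k l)`_j)%:~R| <= Q%:R :> R.
  rewrite coef_even_tail_poly; case: ltnP => [jr|_]; last first.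
    apply: (@le_trans _ _ 1); last lra.
    by case: (_ == _); rewrite /= ?normr1 ?normr0.
  have h1 := norm_linear_error r B m x y u l kK.
  have h2 := norm_const_error r B m x y u k lK.
  rewrite intrM.
  case: j jr => [|[|j]] jr.
  - have := ler_normD
      (2 * (rounded_coef r B m x y u k l 0%N)%:~R - const_target r B m u x y)
      (const_target r B m u x y).
    by rewrite subrK; lra.
  - have := ler_normD
      (2 * (rounded_coef r B m x y u k l 1%N)%:~R - linear_target r B m u x y)
      (linear_target r B m u x y).
    by rewrite subrK; lra.
  - have mc : (mid_coef B m u j)%:R <= (B.+1 * m)%:R :> R.
      by rewrite ler_nat mid_coef_le // um.
    rewrite [rounded_coef _ _ _ _ _ _ _ _ _]/= ger0_norm ?mulr_ge0 //.
    have h3 : 2 * B.+1%:R * m%:R <= W * m%:R by rewrite ler_wpM2r.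
    have -> : (mid_coef B m u j : int)%:~R = (mid_coef B m u j)%:R :> R by [].
    by rewrite natrM in mc; lra.
apply/bigmax_leqP => j _.
by rewrite -(ler_nat R) natr_absz intr_norm.
Qed.

(** The targets depend only on the higher coefficients, which are read off
    from the polynomial; then so are the shifts. *)
Lemma rounded_poly_inj (R : realType) r B m (x y : R) u u' k k' l l' :
  rounded_poly r B m x y u k l = rounded_poly r B m x y u' k' l' ->
  [/\ forall i, (i < r.+1)%N -> u i = u' i, k = k' & l = l'].
Proof.
move=> PE.
have cE j : (j < r.+3)%N ->
    rounded_coef r B m x y u k l j = rounded_coef r B m x y u' k' l' j.
  move=> jr; have := congr1 (fun p : {poly int} => p`_j) PE.
  by rewrite /= !coef_even_tail_poly jr; lia.
have uu i : (i < r.+1)%N -> u i = u' i.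
  move=> ir; have := cE i.+2; rewrite !ltnS => /(_ ir) [].
  by rewrite /mid_coef => /addnI.
have hE (w : nat -> R) : high_part r B m u w = high_part r B m u' w.
  by congr (_ + _); apply: eq_bigr => i _; rewrite /mid_coef uu.
have lE : linear_target r B m u x y = linear_target r B m u' x y.
  by rewrite /linear_target hE.
split=> //.
  by have := cE 1%N isT; rewrite /rounded_coef /= lE => /addrI [].
have := cE 0%N isT; rewrite /rounded_coef /const_target /= lE hE.
set c := Num.ceil _; lia.
Qed.

(** * The family of points *)

Lemma fset_of_injection (I : finType) (T : choiceType) (F : I -> T) (A : set T) :
  injective F -> (forall i, A (F i)) ->
  exists2 s : {fset T}, [set` s] `<=` A & #|` s| = #|I|.
Proof.
move=> Finj FA; exists [fset x in codom F]%fset.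
  by move=> t /=; rewrite inE => /codomP[i ->].
by rewrite card_fseq undup_id ?size_codom // /codom map_inj_uniq // enum_uniq.
Qed.

Definition center (R : realFieldType) (a b : R) (N i : nat) : R :=
  a + (b - a) / (2 * N%:R) * (2 * i%:R + 1).

Lemma center_ball_itv (R : realFieldType) (a b w : R) (N i : nat) : a < b -> (i < N)%N ->
  `|w - center a b N i| <= (b - a) / (4 * N%:R) -> a <= w <= b.
Proof.
move=> ab iN; have N0 : 0 < N%:R :> R by rewrite ltr0n (leq_trans _ iN).
have iN1 : i%:R + 1 <= N%:R :> R by rewrite natr1 ler_nat.
have i0 : 0 <= i%:R :> R by [].
set q := (b - a) / (4 * N%:R).
have q0 : 0 < q by rewrite divr_gt0 ?mulr_gt0 ?subr_gt0.
have cE : center a b N i = a + 2 * q * (2 * i%:R + 1).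
  by rewrite /center /q; field; rewrite lt0r_neq0.
have bE : b = a + 4 * q * N%:R by rewrite /q; field; rewrite lt0r_neq0.
have qi : 0 <= q * i%:R by rewrite mulr_ge0 // ltW.
have qN : q * (i%:R + 1) <= q * N%:R by rewrite ler_wpM2l // ltW.
rewrite cE ler_norml => /andP[h1 h2]; lra.
Qed.

(** Different centres are at least (b - a) / N apart, which is twice the sum
    of two radii. *)
Lemma center_sep (R : realFieldType) (a b w : R) (N i j : nat) : a < b -> (i < N)%N ->
  `|w - center a b N i| <= (b - a) / (4 * N%:R) ->
  `|w - center a b N j| <= (b - a) / (4 * N%:R) -> i = j.
Proof.
move=> ab iN; have N0 : 0 < N%:R :> R by rewrite ltr0n (leq_trans _ iN).
set q := (b - a) / (4 * N%:R).
have q0 : 0 < q by rewrite divr_gt0 ?mulr_gt0 ?subr_gt0.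
have cE k : center a b N k = a + 2 * q * (2 * k%:R + 1).
  by rewrite /center /q; field; rewrite lt0r_neq0.
rewrite !cE !ler_norml => /andP[h1 h2] /andP[h3 h4].
have no_gap (k l : nat) : (k < l)%N ->
    2 * q * (2 * l%:R + 1) - 2 * q * (2 * k%:R + 1) <= 2 * q -> False.
  move=> kl h; have : q * (k%:R + 1) <= q * l%:R.
    by rewrite ler_wpM2l ?(ltW q0) // natr1 ler_nat.
  lra.
by case: (ltngtP i j) => // ij; exfalso; apply: (no_gap _ _ ij); lra.
Qed.

(** One point for each choice of a centre, of the r + 1 coefficients of
    t^2, ..., t^(r+2), and of two shifts.  M bounds the abscissas and
    ordinates with room for a step of length 1, C bounds all the divided
    differences that occur, and B and D are the resulting bounds for the
    dominance of the coefficient of t^2 and for the height. *)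
Lemma point_family (R : realType) (r : nat) (a b : R) (f : R -> R)
    (L M C eps : R) (B D N m K Q : nat) :
  let rho := (b - a) / (4 * N%:R) in
  a < b -> 0 <= L ->
  (forall x y, a <= x <= b -> a <= y <= b -> `|f x - f y| <= L * `|x - y|) ->
  (forall x, a <= x <= b -> eps <= `|x - f x|) ->
  1 <= M -> (forall x, a <= x <= b -> `|x| + 1 <= M /\ `|f x| + 1 <= M) ->
  (r.+3 ^ 2)%:R * M ^+ r.+3 <= C -> (2 * r + 1)%:R * C <= B%:R ->
  (1 + 2 * r.+1 * B.+1)%:R * C * (1 + M) + 6 <= D%:R ->
  (0 < N)%N -> (0 < m)%N -> (K <= m)%N -> (D * m <= Q)%N ->
  rho <= 1 -> 2 * rho <= eps -> 32 * K%:R * M <= (B * m)%:R * rho * eps ->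
  exists2 s : {fset R * R},
    [set` s] `<=` [set p | a <= p.1 <= b /\ `|p.2 - f p.1| <= (1 + L) * rho]
                 `&` alg_int_points r.+3 Q
    & #|` s| = (N * m ^ r.+1 * (K * K))%N.
Proof.
move=> rho ab L0 lip diag M1 bnd MC CB WD N0 m0 Km DQ rho1 rhoe KB.
have rho0 : 0 < rho by rewrite divr_gt0 ?mulr_gt0 ?subr_gt0 ?ltr0n.
pose I := ('I_N * {ffun 'I_r.+1 -> 'I_m} * ('I_K * 'I_K))%type.
pose u (g : {ffun 'I_r.+1 -> 'I_m}) (i : nat) : nat := g (inord i).
pose c (i : I) := center a b N i.1.1.
pose P (i : I) := rounded_poly r B m (c i) (f (c i)) (u i.1.2) i.2.1 i.2.2.
have um g i : (i < r.+1)%N -> (u g i < m)%N by move=> _; apply: ltn_ord.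
have cab i : a <= c i <= b.
  by apply: (@center_ball_itv _ _ _ _ N i.1.1); rewrite ?subrr ?normr0 ?ltW.
have PF (i : I) : exists p : R * R,
    [/\ `|p.1 - c i| <= rho, `|p.2 - f (c i)| <= rho,
        root (map_poly intr (P i)) p.1 & root (map_poly intr (P i)) p.2].
  have [xM yM] := bnd _ (cab i).
  have near z z' zz := @rounded_poly_root R r B m (c i) (f (c i)) z z' M C rho eps
    (u i.1.2) i.2.1 i.2.2 K M1 xM yM zz m0 (um _) MC CB (ltn_ord _) (ltn_ord _)
    rho0 rho1 rhoe (diag _ (cab i)) KB.
  have [w1 w1c w1r] := near _ _ (or_introl (conj erefl erefl)).
  have [w2 w2c w2r] := near _ _ (or_intror (conj erefl erefl)).
  by exists (w1, w2).
have [F FP] := choice PF.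
have PFmin i : alg_int_minpoly (F i).1 (P i) /\ alg_int_minpoly (F i).2 (P i).
  have [_ _ r1 r2] := FP i.
  have irr : irreducible_poly (map_poly intr (P i) : {poly rat}).
    exact: irreducible_even_tail_poly.
  by split; split=> //; apply: monic_even_tail_poly.
(* The first coordinate alone determines the centre, by separation, and the
   polynomial, by minimality. *)
have Finj : injective F.
  move=> i j Fij.
  have [hi _ _ _] := FP i; have [hj _ _ _] := FP j; rewrite -Fij in hj.
  have cij : i.1.1 = j.1.1 by apply/val_inj/(center_sep ab (ltn_ord _) hi hj).
  have PE : P i = P j.
    apply: (alg_int_minpoly_inj (PFmin i).1); rewrite Fij; exact: (PFmin j).1.
  have := PE; rewrite /P /c cij => /rounded_poly_inj[uE kE lE].
  case: i j {Fij hi hj PE} cij uE kE lE => [[i g] [k l]] [[i' g'] [k' l']] /=.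
  move=> -> uE /val_inj -> /val_inj ->; congr (_, _, _).
  apply/ffunP => j; apply/val_inj.
  by have := uE _ (ltn_ord j); rewrite /u inord_val.
suff FA i : ([set p | a <= p.1 <= b /\ `|p.2 - f p.1| <= (1 + L) * rho]
      `&` alg_int_points r.+3 Q) (F i).
  have [s sA sN] := fset_of_injection Finj FA.
  by exists s => //; rewrite sN !card_prod card_ffun !card_ord.
have [h1 h2 _ _] := FP i; have [m1 m2] := PFmin i.
have Fab : a <= (F i).1 <= b by apply: center_ball_itv h1.
have [xM yM] := bnd _ (cab i).
split; [split=> //=|exists (P i); split=> //].
- apply: le_trans (ler_distD (f (c i)) _ _) _; rewrite mulrDl mul1r.
  apply: lerD => //; apply: le_trans (lip _ _ (cab i) Fab) _.
  by rewrite ler_wpM2l // distrC.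
- exact: size_even_tail_poly.
- apply: (@height_rounded_poly _ _ _ _ _ _ M C _ _ _ K D) => //; try lra.
  exact: um.
Qed.

(** * The Lipschitz property of f *)

Lemma is_derive_of_has_derivative_on (R : realType) (a b x : R) (f df : R -> R) :
  has_derivative_on `[a, b] f df -> x \in `]a, b[ -> is_derive x 1 f (df x).
Proof.
move=> f_diff xab.
suff cv : (fun h => h^-1 *: ((f \o shift x) (h *: 1) - f x)) @ 0^' --> df x.
  by split; [apply/cvg_ex; exists (df x)|apply/cvg_lim].
have xab' : `[a, b]%classic x.
  by move: xab; rewrite /= !in_itv /= => /andP[/ltW -> /ltW ->].
move=> A nA.
have fA : nbhs x [set y | y != x -> `[a, b]%classic y -> A ((f y - f x) / (y - x))].
  exact: f_diff xab' A nA.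
have : nbhs x [set y | y != x -> A ((f y - f x) / (y - x))].
  apply: filterS2 (near_in_itvoo xab) fA => y yab fAy yx; apply: fAy => //.
  by move: yab; rewrite /= !in_itv /= => /andP[/ltW -> /ltW ->].
move=> /nbhs_ballP[e /= e0 eA]; apply/nbhs_ballP; exists e => //= h.
rewrite /ball /= sub0r normrN => he h0 /=.
have := eA (h *: 1 + x); rewrite /ball /= opprD addrCA subrr addr0 normrN.
rewrite [_ *: _]mulr1 => /(_ he).
rewrite addrK mulrC -subr_eq0 addrK; apply.
exact: h0.
Qed.

Lemma lipschitz_of_bounded_derivative (R : realType) (a b : R) (f df : R -> R) :
  a < b -> {within `[a, b], continuous f} -> has_derivative_on `[a, b] f df ->
  (ereal_sup [set `|df x|%:E | x in `[a, b]] < +oo)%E ->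
  exists2 L, 0 <= L &
    forall x y, a <= x <= b -> a <= y <= b -> `|f x - f y| <= L * `|x - y|.
Proof.
move=> ab fc fd.
set S := ereal_sup _ => Soo.
have Sub x : `[a, b]%classic x -> (`|df x|%:E <= S)%E.
  by move=> xab; apply: ereal_sup_ubound; exists x.
have aab : `[a, b]%classic a by rewrite /= in_itv /= lexx ltW.
have [L SL] : exists L, S = L%:E.
  by case: S Soo Sub => [L||] // _ Sub; [exists L|have := Sub _ aab].
have L0 : 0 <= L by have := Sub _ aab; rewrite SL lee_fin; apply: le_trans.
exists L => //.
suff lt_case x y : a <= x -> y <= b -> x < y -> `|f y - f x| <= L * `|y - x|.
  move=> x y /andP[ax xb] /andP[ay yb]; case: (ltgtP x y) => [xy|yx|->].
  - by rewrite distrC [X in _ * X]distrC lt_case.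
  - exact: lt_case.
  - by rewrite !subrr normr0 mulr0.
move=> ax yb xy.
have [| |z zxy ->] := @MVT R f df x y xy.
- move=> z zxy; apply: (is_derive_of_has_derivative_on fd).
  move: zxy; rewrite !in_itv /= => /andP[xz zy].
  by rewrite (le_lt_trans ax) // (lt_le_trans zy).
- apply: continuous_subspaceW fc => z /=; rewrite !in_itv /= => /andP[xz zy].
  by rewrite (le_trans ax) // (le_trans zy).
rewrite normrM ler_wpM2r //; have := Sub z; rewrite SL lee_fin; apply.
move: zxy; rewrite /= !in_itv /= => /andP[xz zy].
by rewrite (le_trans ax (ltW xz)) (le_trans (ltW zy)).
Qed.

(** * Counting *)

(** Read with m = Q / D and K = m / (E N), both rounded down: rounding loses at
    most a factor 2, so that K is at least m / (2 E N) and m at least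
    Q / (2 D). *)
Lemma family_size_ge (r m E N K D Q : nat) :
  (0 < m)%N -> (0 < K)%N -> (m < K.+1 * (E * N))%N -> (Q < m.+1 * D)%N ->
  (Q ^ r.+3 <= N * m ^ r.+1 * (K * K) * (4 * E ^ 2 * (2 * D) ^ r.+3 * N))%N.
Proof.
move=> m0 K0 mK Qm.
have h1 : (Q <= 2 * D * m)%N by nia.
have h2 : (m <= 2 * K * E * N)%N by nia.
apply: (@leq_trans ((2 * D * m) ^ r.+3)); first by rewrite leq_exp2r.
have mE : (m ^ r.+3 = m ^ r.+1 * m ^ 2)%N by rewrite -expnD addn2.
rewrite expnMn mE.
have h3 : (m ^ 2 <= (2 * K * E * N) ^ 2)%N by rewrite leq_exp2r.
rewrite [leqRHS](_ : _ = (2 * D) ^ r.+3 * (m ^ r.+1 * (2 * K * E * N) ^ 2))%N.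
  by rewrite !leq_mul2l h3 !orbT.
by rewrite !expnMn -!mulnn; lia.
Qed.

Lemma exists_nat_ge (R : realType) (x : R) : exists2 N : nat, (0 < N)%N & x <= N%:R.
Proof. by exists (Num.truncn x).+1 => //; rewrite ltW // truncnS_gt. Qed.

Theorem theorem1p4 (R : realType) (n : nat) (a b : R) (f df : R -> R)
    (epsilon lambda c8 : R)
    (hn : (4 <= n)%N)
    (hab : a < b)
    (f_cont : {within `[a, b], continuous f})
    (f_diff : has_derivative_on `[a, b] f df)
    (df_bnd : (ereal_sup [set `|df x|%:E | x in `[a, b]] < +oo)%E)
    (heps : 0 < epsilon)
    (f_diag : forall x, x \in `[a, b] -> epsilon < `|f x - x|)
    (hlambda0 : 0 < lambda)
    (hlambda1 : lambda < 1 / 2)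
    (hc8 : 0 < c8) :
  exists c9 Q0 : R,
    [/\ 0 < c9, 0 < Q0 &
        forall Q : nat, Q0 < Q%:R ->
          exists s : {fset R * R},
            [set` s] `<=`
              strip `[a, b] f c8 lambda Q `&` alg_int_points n Q /\
            c9 * Q%:R `^ (n%:R - lambda) <= #|` s|%:R].
Proof.
have [L L0 lip] := lipschitz_of_bounded_derivative hab f_cont f_diff df_bnd.
case: n hn => [|[|[|r]]] // _.
have ba0 : 0 < b - a by rewrite subr_gt0.
pose M := 2 + (`|a| + `|b|) + (`|f a| + L * (b - a)).
have Lba : 0 <= L * (b - a) by rewrite mulr_ge0 // ltW.
have M1 : 1 <= M.
  by rewrite /M; have := normr_ge0 a; have := normr_ge0 b; have := normr_ge0 (f a); lra.
have bnd x : a <= x <= b -> `|x| + 1 <= M /\ `|f x| + 1 <= M.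
  move=> xab; have /andP[ax xb] := xab.
  have na := normr_ge0 a; have nb := normr_ge0 b; have nfa := normr_ge0 (f a).
  have xn : `|x| <= `|a| + `|b|.
    rewrite ler_norml; have := ler_norm b; have := ler_norm (- a); rewrite normrN; lra.
  have fx : `|f x| <= `|f a| + L * (b - a).
    rewrite -[f x](subrK (f a)) addrC (le_trans (ler_normD _ _)) // lerD2l.
    apply: le_trans (lip _ _ xab _) _; first by rewrite lexx ltW.
    by rewrite ler_wpM2l // ger0_norm; lra.
  by rewrite /M; split; lra.
pose C := (r.+3 ^ 2)%:R * M ^+ r.+3.
have [B B0 CB] := exists_nat_ge ((2 * r + 1)%:R * C).
have [D D0 WD] := exists_nat_ge ((1 + 2 * r.+1 * B.+1)%:R * C * (1 + M) + 6).
have [E E0 ME] := exists_nat_ge (128 * M / ((b - a) * epsilon)).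
(* The three summands other than 1 make the radius rho at most 1 / 4, at
   most epsilon / 4, and small enough for the squares to stay in the strip. *)
pose nu := 1 + (b - a) + (b - a) / epsilon + (1 + L) * (b - a) / c8.
have nu1 : 1 <= nu.
  have h1 : 0 < (b - a) / epsilon by rewrite divr_gt0.
  have h2 : 0 < (1 + L) * (b - a) / c8 by rewrite divr_gt0 // mulr_gt0 //; lra.
  by rewrite /nu; lra.
have nu0 : 0 < nu by lra.
have ER0 : 0 < E%:R :> R by rewrite ltr0n.
have DR0 : 0 < D%:R :> R by rewrite ltr0n.
(* A T <= Q, where T = Q^lambda, leaves room for at least one shift: it
   gives E N <= Q / D. *)
pose A := 2 * nu * E%:R * D%:R.
have A0 : 0 < A by rewrite !mulr_gt0.
pose G : R := E%:R ^+ 2 * (2 * D%:R) ^+ r.+3.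
have G0 : 0 < G by rewrite mulr_gt0 // exprn_gt0 // mulr_gt0.
have nuG0 : 0 < 8 * G * nu by rewrite mulr_gt0 // mulr_gt0.
exists (8 * G * nu)^-1, (A `^ (1 - lambda)^-1).
split; first by rewrite invr_gt0.
  by apply: powR_gt0.
move=> Q QA.
have Q0 : 0 < Q%:R :> R by apply: le_lt_trans QA; exact: powR_ge0.
have Q1 : 1 <= Q%:R :> R by rewrite ler1n -(ltr0n R).
pose T := Q%:R `^ lambda.
have T1 : 1 <= T.
  rewrite -[leLHS](congr1 (@^~ lambda) (powR1 R)).
  by apply: ge0_ler_powR; rewrite ?nnegrE // ltW.
have T0 : 0 < T by lra.
have AT : A * T <= Q%:R.
  have lam1 : 0 < 1 - lambda by lra.
  have hA : A <= Q%:R `^ (1 - lambda).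
    have -> : A = (A `^ (1 - lambda)^-1) `^ (1 - lambda).
      by rewrite -powRrM mulVf ?lt0r_neq0 // powRr1 // ltW.
    by apply: ge0_ler_powR; rewrite ?nnegrE ?powR_ge0 ?(ltW lam1) ?(ltW Q0) ?(ltW QA).
  apply: le_trans (ler_wpM2r (ltW T0) hA) _.
  by rewrite /T -powRD ?subrK ?powRr1 // (gt_eqF Q0) implybT.
pose N := (Num.truncn (nu * T)).+1.
have nT0 : 0 <= nu * T by rewrite mulr_ge0 // ltW.
have NnT : nu * T < N%:R by exact: truncnS_gt.
have nTN : N%:R <= 2 * nu * T.
  have NE : N%:R = (Num.truncn (nu * T))%:R + 1 :> R by rewrite /N -natr1.
  have : (Num.truncn (nu * T))%:R <= nu * T by rewrite truncn_le.
  have : 1 <= nu * T by rewrite -[leLHS]mul1r ler_pM.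
  by rewrite NE; lra.
have N0 : 0 < N%:R :> R by [].
pose m := (Q %/ D)%N; pose K := (m %/ (E * N))%N.
have ENm : (E * N <= m)%N.
  rewrite leq_divRL // -(ler_nat R) !natrM; apply: le_trans AT.
  by rewrite /A; have := ler_wpM2l (ltW (mulr_gt0 ER0 DR0)) nTN; lra.
have EN0 : (0 < E * N)%N by rewrite muln_gt0 E0.
have m0 : (0 < m)%N by exact: leq_trans ENm.
have K0 : (0 < K)%N by rewrite divn_gt0.
have KENm : (K * (E * N) <= m)%N by exact: leq_divM.
have Km : (K <= m)%N by exact: leq_div.
pose rho := (b - a) / (4 * N%:R).
have rhoN : rho * (4 * N%:R) = b - a.
  by rewrite /rho divfK // lt0r_neq0 // mulr_gt0.
have rho0 : 0 < rho by rewrite divr_gt0 // mulr_gt0.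
have nuN : nu <= N%:R.
  by apply: le_trans (ltW NnT); rewrite ler_peMr // ltW.
have rho_le (c : R) : 0 < c -> (b - a) / c <= nu -> 4 * rho <= c.
  move=> c0; rewrite ler_pdivrMr // => h.
  have h1 : rho * (4 * N%:R) <= N%:R * c.
    by rewrite rhoN (le_trans h) // ler_wpM2r // ltW.
  by rewrite -(ler_pM2r N0); lra.
have nuE1 : 0 < (b - a) / epsilon by rewrite divr_gt0.
have nuE2 : 0 < (1 + L) * (b - a) / c8 by rewrite divr_gt0 // mulr_gt0 //; lra.
have rho1 : 4 * rho <= 1 by apply: rho_le => //; rewrite divr1 /nu; lra.
have rhoe : 4 * rho <= epsilon by apply: rho_le => //; rewrite /nu; lra.
(* 32 K M <= 32 M m / (E N), and the choice of E makes this at most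
   m (b - a) epsilon / (4 N) = m rho epsilon. *)
have KB : 32 * K%:R * M <= (B * m)%:R * rho * epsilon.
  have h1 : 128 * M <= E%:R * ((b - a) * epsilon).
    by rewrite -ler_pdivrMr // mulr_gt0.
  have h2 : K%:R * (E%:R * N%:R) <= (B * m)%:R :> R.
    by rewrite -!natrM ler_nat (leq_trans KENm) // leq_pmull.
  have re0 : 0 <= rho * epsilon by rewrite mulr_ge0 // ltW.
  have h3 := ler_wpM2r re0 h2.
  have h4 : K%:R * (128 * M) <= K%:R * (E%:R * ((b - a) * epsilon)) by rewrite ler_wpM2l.
  by rewrite -rhoN in h4; lra.
have diag x : a <= x <= b -> epsilon <= `|x - f x|.
  by move=> xab; rewrite distrC ltW // f_diag // in_itv.
have rho1' : rho <= 1 by lra.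
have rhoe' : 2 * rho <= epsilon by lra.
have DmQ : (D * m <= Q)%N by rewrite mulnC leq_divM.
have [s sA sN] := point_family hab L0 lip diag M1 bnd (lexx _) CB WD
  (isT : (0 < N)%N) m0 Km DmQ rho1' rhoe' KB.
exists s; split.
  move=> p /sA[[pab pf] pP]; split=> //; split; first by rewrite /= in_itv.
  apply: le_lt_trans pf _; rewrite powRN -/T.
  rewrite ltr_pdivlMr // -/rho.
  have h1 : (1 + L) * (b - a) <= nu * c8.
    by rewrite -ler_pdivrMr // /nu; lra.
  have h2 : nu * T * c8 < N%:R * c8 by rewrite ltr_pM2r.
  rewrite -rhoN in h1; have h3 := ler_wpM2r (ltW T0) h1.
  by rewrite -(ltr_pM2r N0); have := mulr_gt0 N0 hc8; lra.
have count := family_size_ge r m0 K0 (ltn_ceil _ EN0) (ltn_ceil _ D0).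
rewrite -sN -(ler_nat R) !(natrM, natrX) in count.
have QE : Q%:R `^ (r.+3%:R - lambda) = Q%:R ^+ r.+3 / T.
  by rewrite powRB ?powR_mulrn // (gt_eqF Q0) implybT.
rewrite QE mulrC ler_pdivrMr // ler_pdivrMr //; apply: le_trans count _.
rewrite -[leRHS]mulrA; apply: ler_wpM2l => //.
have := ler_wpM2l (ltW G0) nTN; rewrite /G; lra.
Qed.
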